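(* Let $\mathbf{i}$ and $\mathbf{j}$ be ideals in $\mathbb{N}$ with $\mathbf{i}\Subset\mathbf{j}$. Then the closed unit ball of the quotient Banach space $\mathbf{j}c_0/\mathbf{i}c_0$ does not embed uniformly continuously into $\mathbf{j}c_0$. In particular, $\mathbf{i}c_0$ is not complemented in $\mathbf{j}c_0$, and furthermore the quotient map $q:\mathbf{j}c_0\to\mathbf{j}c_0/\mathbf{i}c_0$ does not admit a uniformly continuous right inverse, i.e. there is no uniformly continuous map $\tau:\mathbf{j}c_0/\mathbf{i}c_0\to\mathbf{j}c_0$ such that $q\circ\tau$ is the identity on $\mathbf{j}c_0/\mathbf{i}c_0$.
   Context: All vector spaces are over $\mathbb{R}$, and $\mathbb{N}=\{1,2,3,\ldots\}$. A set $\mathbf{i}\subseteq 2^{\mathbb{N}}$ is an ideal in $\mathbb{N}$ if (1) $A,B\in\mathbf{i}$ implies $A\cup B\in\mathbf{i}$, and (2) $A\in\mathbf{i}$ and $B\subseteq A$ imply $B\in\mathbf{i}$. A real sequence $(r_n)_{n\in\mathbb{N}}$ $\mathbf{i}$-converges to $r\in\mathbb{R}$ if $\{n\in\mathbb{N}: |r_n-r|\geq\varepsilon\}\in\mathbf{i}$ for every $\varepsilon>0$. $\ell^\infty$ is the space of bounded real sequences with the supremum norm, and $\mathbf{i}c_0$ denotes the closed subspace of $\ell^\infty$ of all bounded sequences that $\mathbf{i}$-converge to $0$. For ideals $\mathbf{i},\mathbf{j}$ in $\mathbb{N}$, we write $\mathbf{i}\Subset\mathbf{j}$ ($\mathbf{j}$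 is much larger than $\mathbf{i}$) if $\mathbf{i}\subsetneq\mathbf{j}$ and there exists a countable collection $\{D_j\}_{j\in\mathbb{N}}\subseteq\mathbf{i}$ of non-empty pairwise disjoint sets such that $\bigcup_{k\in K}D_k\in\mathbf{j}\setminus\mathbf{i}$ for every infinite subset $K\subseteq\mathbb{N}$. A subset $B$ of a Banach space embeds uniformly continuously into a Banach space $Y$ if there is an injective uniformly continuous map $f:B\to Y$ whose inverse $f(B)\to B$ is uniformly continuous. *)

(* Defs.v *)
From HB Require Import structures.
From mathcomp Require Import all_boot all_order all_algebra.
From mathcomp Require Import generic_quotient ring_quotient.
From mathcomp Require Import all_classical all_reals all_analysis.

Set Implicit Arguments.
Unset Strict Implicit.
Unset Printing Implicit Defensive.

Import Order.TTheory GRing.Theory Num.Theory.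
Import numFieldNormedType.Exports.

Local Open Scope classical_set_scope.
Local Open Scope ring_scope.
Local Open Scope quotient_scope.

(* The index set {1, 2, 3, ...} is represented by nat; only its countably
   infinite cardinality matters below. *)

(* The empty family satisfies [is_ideal], but then no sequence converges and
   [ideal_c0] is empty: hence the non-emptiness argument of [ideal_c0_space]. *)
Definition is_ideal (I : set (set nat)) : Prop :=
  (forall A B, I A -> I B -> I (A `|` B)) /\
  (forall A B, I A -> B `<=` A -> I B).

Definition ideal_cvg (R : realType) (I : set (set nat)) (r : nat -> R) (l : R)
  : Prop :=
  forall eps : R, 0 < eps -> I [set n | eps <= `|r n - l|].

Definition much_larger (I J : set (set nat)) : Prop :=
  I `<` J /\
  exists D : nat -> set nat,
    [/\ forall k, I (D k),
        forall k, D k !=set0,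
        trivIset [set: nat] D &
        forall K : set nat, infinite_set K -> (J `\` I) (\bigcup_(k in K) D k)].

Lemma much_larger_neq0l (I J : set (set nat)) : much_larger I J -> I !=set0.
Proof. by case=> _ [D [DI _ _ _]]; exists (D 0%N). Qed.

Lemma much_larger_neq0r (I J : set (set nat)) : much_larger I J -> J !=set0.
Proof. by case=> -[IJ _] [D [DI _ _ _]]; exists (D 0%N); exact: IJ. Qed.

Section linfty.
Variable R : realType.

Definition bounded_seq : {pred nat -> R^o} := fun u => `[< bounded_fun u >].

Lemma bounded_seqP (u : nat -> R^o) :
  u \in bounded_seq <-> exists M : R, forall n, `|u n| <= M.
Proof.
have pF : ProperFilter (globally [set: nat]).
  exact: (globally_properfilter (a := 0%N)).
split=> [/asboolP/(@ex_bound _ _ _ u _ pF)[M hM]|[M hM]].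
  by exists M => n; exact: hM.
by apply/asboolP/(@ex_bound _ _ _ u _ pF); exists M => n _; exact: hM.
Qed.

Lemma bounded_seq_submod_closed : submod_closed bounded_seq.
Proof.
split; first by apply/bounded_seqP; exists 0 => n; rewrite normr0.
move=> a u v /bounded_seqP[M hM] /bounded_seqP[N hN].
apply/bounded_seqP; exists (`|a| * M + N) => n.
rewrite (le_trans (ler_normD _ _))// lerD//.
by rewrite normrZ ler_wpM2l.
Qed.

HB.instance Definition _ :=
  GRing.isSubmodClosed.Build R _ bounded_seq bounded_seq_submod_closed.

Record linfty : Type := Linfty {
  linfty_val :> nat -> R^o;
  linfty_valP : linfty_val \in bounded_seq }.

HB.instance Definition _ := [isSub for linfty_val].
HB.instance Definition _ := [Choice of linfty by <:].
HB.instance Definition _ := [SubChoice_isSubLmodule of linfty by <:].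

Definition sup_norm (u : linfty) : R := sup (range (fun n => `|u n|)).

Lemma has_sup_linfty (u : linfty) : has_sup (range (fun n => `|u n|)).
Proof.
split; first by exists `|u 0%N|, 0%N.
have /bounded_seqP[M hM] := linfty_valP u.
by exists M => _ [n _ <-].
Qed.

Lemma ler_sup_norm (u : linfty) n : `|u n| <= sup_norm u.
Proof. by apply: ub_le_sup; [case: (has_sup_linfty u)|exists n]. Qed.

Lemma sup_norm_le (u : linfty) (M : R) :
  (forall n, `|u n| <= M) -> sup_norm u <= M.
Proof.
move=> hM; apply: ge_sup; first by case: (has_sup_linfty u).
by move=> _ [n _ <-].
Qed.

Lemma sup_normD (u v : linfty) : sup_norm (u + v) <= sup_norm u + sup_norm v.
Proof.
apply: sup_norm_le => n.
by rewrite (le_trans (ler_normD _ _))// lerD ?ler_sup_norm.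
Qed.

Lemma sup_normZ (a : R) (u : linfty) : sup_norm (a *: u) = `|a| * sup_norm u.
Proof.
have le b (v : linfty) : sup_norm (b *: v) <= `|b| * sup_norm v.
  by apply: sup_norm_le => n; rewrite normrZ ler_wpM2l ?ler_sup_norm.
apply/le_anti; rewrite le/=.
have [->|a0] := eqVneq a 0.
  by rewrite normr0 mul0r (le_trans (normr_ge0 _) (ler_sup_norm _ 0%N)).
rewrite -ler_pdivlMl ?normr_gt0// -normfV -[X in sup_norm X <= _]scale1r.
by rewrite -(mulVf a0) -scalerA le.
Qed.

Lemma sup_norm_eq0 (u : linfty) : sup_norm u = 0 -> u = 0.
Proof.
move=> u0; apply/val_inj/funext => n; apply/eqP; rewrite -normr_le0 -u0.
exact: ler_sup_norm.
Qed.

HB.instance Definition _ :=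
  @Lmodule_isNormed.Build R linfty sup_norm sup_normD sup_normZ sup_norm_eq0.

End linfty.

Section closed_subspaces.
Variables (R : realType) (V : normedModType R).

Record closedSubspace : Type := ClosedSubspace {
  csub_set :> set V;
  csub0 : csub_set 0;
  csubDZ : forall (a : R) x y, csub_set x -> csub_set y ->
    csub_set (a *: x + y);
  csub_closed : closed csub_set }.

Definition csub_mem (S : closedSubspace) : {pred V} := fun x => `[< csub_set S x >].

Lemma csub_memP S x : reflect (csub_set S x) (x \in csub_mem S).
Proof. exact: asboolP. Qed.

Lemma csub_submod_closed S : submod_closed (csub_mem S).
Proof.
split; first exact/csub_memP/csub0.
by move=> a x y /csub_memP Sx /csub_memP Sy; apply/csub_memP/csubDZ.
Qed.

HB.instance Definition _ S :=
  GRing.isSubmodClosed.Build R V (csub_mem S) (csub_submod_closed S).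

(* A closed subspace as a normed space in its own right. *)
Record subNormed (S : closedSubspace) : Type := SubNormed {
  subNormed_val :> V;
  subNormed_valP : subNormed_val \in csub_mem S }.

HB.instance Definition _ S := [isSub for @subNormed_val S].
HB.instance Definition _ S := [Choice of subNormed S by <:].
HB.instance Definition _ S := [SubChoice_isSubLmodule of subNormed S by <:].

Section sub_norm.
Variable S : closedSubspace.
Implicit Types x y : subNormed S.

Let nrm x : R := `|subNormed_val x|.

Let nrmD x y : nrm (x + y) <= nrm x + nrm y.
Proof. exact: ler_normD. Qed.

Let nrmZ (a : R) x : nrm (a *: x) = `|a| * nrm x.
Proof. exact: normrZ. Qed.

Let nrm_eq0 x : nrm x = 0 -> x = 0.
Proof. by move=> /eqP; rewrite normr_eq0 => /eqP x0; exact: val_inj. Qed.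

HB.instance Definition _ :=
  @Lmodule_isNormed.Build R (subNormed S) nrm nrmD nrmZ nrm_eq0.

End sub_norm.

Definition quotNormed (S : closedSubspace) : Type := Quotient.quot (csub_mem S).

HB.instance Definition _ S := GRing.Zmodule.on (quotNormed S).
HB.instance Definition _ S := EqQuotient.on (quotNormed S).
HB.instance Definition _ S := ZmodQuotient.on (quotNormed S).

Definition quot_map S (x : V) : quotNormed S := \pi_(quotNormed S) x.

Section quot_norm.
Variable S : closedSubspace.
Local Notation Q := (quotNormed S).
Local Notation q := (@quot_map S).

Lemma quot_mapP x y : q x = q y <-> csub_set S (x - y).
Proof.
split.
  by move=> /eqP; rewrite /quot_map -Quotient.idealrBE => /csub_memP.
by move=> /csub_memP h; apply/eqP; rewrite /quot_map -Quotient.idealrBE.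
Qed.

Lemma quot_map_surj (z : Q) : exists x, q x = z.
Proof. by exists (repr z); rewrite /quot_map reprK. Qed.

Lemma quot_mapD x y : q (x + y) = q x + q y.
Proof. by rewrite /quot_map piE. Qed.

Lemma csubZ (a : R) x : csub_set S x -> csub_set S (a *: x).
Proof. by move=> Sx; rewrite -[_ *: _]addr0; apply: csubDZ => //; exact: csub0. Qed.

Definition quot_scale (a : R) (z : Q) : Q := q (a *: repr z).

Lemma quot_scaleE a x : quot_scale a (q x) = q (a *: x).
Proof.
apply/quot_mapP; rewrite -scalerBr; apply/csubZ/quot_mapP.
by rewrite /quot_map reprK.
Qed.

Let scaleA a b z : quot_scale a (quot_scale b z) = quot_scale (a * b) z.
Proof.
by have [x <-] := quot_map_surj z; rewrite !quot_scaleE scalerA.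
Qed.

Let scale1 : left_id 1 quot_scale.
Proof. by move=> z; have [x <-] := quot_map_surj z; rewrite quot_scaleE scale1r. Qed.

Let scaleDr : right_distributive quot_scale +%R.
Proof.
move=> a z w; have [x <-] := quot_map_surj z; have [y <-] := quot_map_surj w.
by rewrite -quot_mapD !quot_scaleE scalerDr quot_mapD.
Qed.

Let scaleDl z : {morph quot_scale^~ z : a b / a + b}.
Proof.
move=> a b; have [x <-] := quot_map_surj z.
by rewrite !quot_scaleE scalerDl quot_mapD.
Qed.

HB.instance Definition _ :=
  GRing.Zmodule_isLmodule.Build R Q scaleA scale1 scaleDr scaleDl.

Lemma quot_mapZ a x : q (a *: x) = a *: q x.
Proof. by rewrite [RHS]quot_scaleE. Qed.

Definition quot_norm (z : Q) : R := inf [set `|x| | x in [set x | q x = z]].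

Lemma quot_norm_has_inf z : has_inf [set `|x| | x in [set x | q x = z]].
Proof.
split; first by have [x xz] := quot_map_surj z; exists `|x|, x.
by exists 0 => _ [x _ <-].
Qed.

Lemma quot_norm_le x : quot_norm (q x) <= `|x|.
Proof. by apply: ge_inf; [case: (quot_norm_has_inf (q x))|exists x]. Qed.

Lemma quot_norm_ge0 z : 0 <= quot_norm z.
Proof.
apply: lb_le_inf; first by case: (quot_norm_has_inf z).
by move=> _ [x _ <-].
Qed.

Lemma quot_norm_lt z (e : R) : 0 < e ->
  exists2 x, q x = z & `|x| < quot_norm z + e.
Proof.
move=> e0; have [_ [x xz <-] h] := inf_adherent e0 (quot_norm_has_inf z).
by exists x.
Qed.

Let quot_normD z w : quot_norm (z + w) <= quot_norm z + quot_norm w.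
Proof.
apply/ler_addgt0Pr => e e0.
have e20 : 0 < e / 2 by rewrite divr_gt0.
have [x xz hx] := quot_norm_lt z e20; have [y yw hy] := quot_norm_lt w e20.
rewrite -xz -yw -quot_mapD (le_trans (quot_norm_le _))//.
rewrite (le_trans (ler_normD _ _))// [e]splitr addrACA xz yw.
by rewrite lerD// ltW.
Qed.

Let quot_normZ (a : R) z : quot_norm (a *: z) = `|a| * quot_norm z.
Proof.
have le b w : quot_norm (b *: w) <= `|b| * quot_norm w.
  have [->|b0] := eqVneq b 0.
    rewrite scale0r normr0 mul0r -[0 in X in X <= _](_ : q 0 = 0).
      by rewrite (le_trans (quot_norm_le _))// normr0.
    by rewrite -(scale0r (0 : V)) quot_mapZ scale0r.
  rewrite -ler_pdivrMl ?normr_gt0//; apply/ler_addgt0Pr => e e0.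
  have [x <- hx] := quot_norm_lt w e0.
  rewrite ler_pdivrMl ?normr_gt0// -quot_mapZ (le_trans (quot_norm_le _))//.
  by rewrite normrZ ler_wpM2l// ltW// hx.
apply/le_anti; rewrite le/=.
have [->|a0] := eqVneq a 0; first by rewrite normr0 mul0r quot_norm_ge0.
rewrite -ler_pdivlMl ?normr_gt0// -normfV -[X in quot_norm X <= _]scale1r.
by rewrite -(mulVf a0) -scalerA le.
Qed.

Let quot_norm_eq0 z : quot_norm z = 0 -> z = 0.
Proof.
have [x <-] := quot_map_surj z => x0.
have -> : 0 = q 0 by rewrite -(scale0r (0 : V)) quot_mapZ scale0r.
apply/quot_mapP; rewrite subr0; apply: (@csub_closed S).
move=> B /nbhs_ballP[e /= e0 eB].
have [y yx] := quot_norm_lt (q x) e0; rewrite x0 add0r => ye.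
exists (x - y); split; first exact/quot_mapP.
by apply: eB; rewrite -ball_normE/= opprB addrC subrK.
Qed.

HB.instance Definition _ := @Lmodule_isNormed.Build R Q quot_norm
  quot_normD quot_normZ quot_norm_eq0.

End quot_norm.

End closed_subspaces.

(* [subspace B] carries the uniformity induced on B by the ambient space; the
   values of f and g outside B and f @` B are irrelevant. *)
Definition unif_embeds (X Y : uniformType) (B : set X) : Prop :=
  exists f : X -> Y,
    [/\ set_inj B f,
        unif_continuous (f : subspace B -> Y) &
        exists2 g : Y -> X, {in B, cancel f g} &
          unif_continuous (g : subspace (f @` B) -> X)].
Arguments unif_embeds {X} Y B.

Definition complemented (R : realType) (V : normedModType R) (M : set V) : Prop :=
  exists P : {linear V -> V},
    [/\ continuous P, forall x, P (P x) = P x & range P = M].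

Section ideal_c0.
Variable R : realType.

Definition ideal_c0 (I : set (set nat)) : set (linfty R) :=
  [set u | ideal_cvg I u 0].

Section closed_subspace.
Variables (I : set (set nat)) (idI : is_ideal I) (I0 : I !=set0).

Lemma ideal_c0P (u : linfty R) :
  ideal_c0 I u <-> forall e : R, 0 < e -> I [set n | e <= `|u n|].
Proof.
split=> h e e0; have := h e e0; congr I; apply/seteqP; split=> n /=;
  by rewrite subr0.
Qed.

Let c00 : ideal_c0 I 0.
Proof.
apply/ideal_c0P => e e0; have [A IA] := I0; apply: (idI.2 A) => // n /=.
by rewrite normr0 leNgt e0.
Qed.

Let c0DZ (a : R) u v : ideal_c0 I u -> ideal_c0 I v -> ideal_c0 I (a *: u + v).
Proof.
move=> /ideal_c0P hu /ideal_c0P hv; apply/ideal_c0P => e e0.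
have e20 : 0 < e / 2 by rewrite divr_gt0.
have a1 : 0 < `|a| + 1 by rewrite ltr_wpDl.
apply: (idI.2 _ _ (idI.1 _ _ (hu _ (divr_gt0 e20 a1)) (hv _ e20))) => n /= hn.
apply/orP; rewrite -implyNb; apply/implyP; rewrite -ltNge => un.
rewrite leNgt; apply/negP => vn; move: hn; apply/negP; rewrite -ltNge.
rewrite (le_lt_trans (ler_normD _ _))// [ltRHS]splitr ler_ltD//.
rewrite normrZ; move: un; rewrite ltr_pdivlMr// => /ltW; apply: le_trans.
by rewrite mulrC ler_wpM2l// lerDl.
Qed.

Let c0_closed : closed (ideal_c0 I).
Proof.
move=> u hu; apply/ideal_c0P => e e0.
have e20 : 0 < e / 2 by rewrite divr_gt0.
have [v [/ideal_c0P hv]] := hu _ (nbhsx_ballx u _ e20).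
rewrite -ball_normE/= => uv; apply: (idI.2 _ _ (hv _ e20)) => n /= un.
rewrite -(lerD2l (e / 2)) -splitr (le_trans un)//.
rewrite -[u n](subrK (v n)) (le_trans (ler_normD _ _))// lerD2r.
exact: le_trans (ler_sup_norm (u - v) n) (ltW uv).
Qed.

Definition ideal_c0_space : closedSubspace (linfty R) :=
  ClosedSubspace c00 c0DZ c0_closed.

End closed_subspace.

(* For closed subspaces S and T of V, the trace of S on T as a closed subspace
   of T; it is S itself when S is contained in T. *)
Section trace.
Variables (V : normedModType R) (S T : closedSubspace V).

Definition trace_set : set (subNormed T) := [set x | csub_set S (subNormed_val x)].

Let trace0 : trace_set 0.
Proof. exact: csub0. Qed.

Let traceDZ (a : R) x y : trace_set x -> trace_set y -> trace_set (a *: x + y).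
Proof. exact: csubDZ. Qed.

Let trace_closed : closed trace_set.
Proof.
move=> x hx; apply: (@csub_closed _ _ S) => B /nbhs_ballP[e /= e0 eB].
have [y [Sy]] := hx _ (nbhsx_ballx x _ e0).
rewrite -ball_normE/= => xy; exists (subNormed_val y); split => //.
by apply: eB; rewrite -ball_normE.
Qed.

Definition trace_space : closedSubspace (subNormed T) :=
  ClosedSubspace trace0 traceDZ trace_closed.

End trace.

Lemma ideal_c0_subset (I J : set (set nat)) :
  I `<=` J -> ideal_c0 I `<=` ideal_c0 J.
Proof. by move=> IJ u hu e e0; exact/IJ/hu. Qed.

End ideal_c0.

(* Main.v *)
Require Import Defs.
From mathcomp Require Import all_boot all_order all_algebra.
From mathcomp Require Import all_classical all_reals all_analysis.
From mathcomp Require Import lra.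

Import Order.TTheory GRing.Theory Num.Theory.
Import numFieldNormedType.Exports.

Local Open Scope classical_set_scope.
Local Open Scope ring_scope.

Set Implicit Arguments.
Unset Strict Implicit.
Unset Printing Implicit Defensive.

(** Write Q for the quotient of the two spaces of ideal-null sequences. The
    argument follows the idea of Kalton's theorem that the unit ball of the
    quotient of the bounded sequences by the null sequences does not embed
    uniformly into the space of bounded sequences: the set of n-tuples of an
    increasing chain of uncountable cofinality, joined when they interlace,
    has no faithful uniform image in a space of sequences.

    The chain is replaced by the functions nat -> nat ordered by eventual
    strict domination, which is only countably directed: every countable
    family has a strict upper bound ([eventually_lt_bounded]). Reindexing the
    disjoint sets D_k by pairs, put E f for the union of the D_(m, n) with
    n <= f m. When g dominates f, the set E f \ E g lies in finitely many of
    the D_k, hence in i, while E g \ E f contains infinitely many of them,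
    hence is not in i ([much_larger_almost_increasing]).

    To a finite sequence s of n functions attach the average in Q of the
    indicators of the E f, f in s. If s and t interlace, i.e.
    s_1 < t_1 < s_2 < t_2 < ..., the difference of the sums of indicators is
    0 or 1 off a set of i, so the averages are 1/n apart at most
    ([quot_average_interlaced]). If all of s lies below all of t with room in
    between, the difference of the averages is 1 on a set outside i, so they
    are at distance 1 at least ([quot_average_separated]).

    Let F be a map from Q to bounded sequences, uniformly continuous on the
    unit ball. For n large every entry of F varies by at most e along
    interlaced tuples. Such a real function stays in an interval of length
    3 e for all s_1 far out, all s_2 far out depending on s_1, and so on
    ([ev_window]). Countable directedness lets one impose this for all the
    entries at the same time; choosing s, and then t far above s, gives two
    points of the unit ball of Q at distance 1 at least whose images are 3 e
    apart at most ([unif_continuous_collapse]). So F has no uniformly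
    continuous inverse, and in particular F is not a right inverse of the
    1-Lipschitz quotient map. A bounded projection P would give the Lipschitz
    right inverse induced by id - P ([complemented_section]). *)

(** * Iterated quantifiers along a countably directed order *)

Section iterated_quantifiers.
Variables (T : Type) (lt : rel T).
Hypothesis lt_trans : transitive lt.
Hypothesis lt_bounded : forall s : nat -> T, exists b, forall k, lt (s k) b.

(** The n-fold iterate of the quantifier of the filter of tails of lt: how far
    out the next entry has to be may depend on the previous ones. *)
Fixpoint ev (n : nat) (P : seq T -> Prop) : Prop :=
  if n is m.+1 then
    exists c, forall a, lt c a -> ev m (fun s => P (a :: s))
  else P [::].

(** The quantifier dual to [ev]. *)
Fixpoint freq (n : nat) (P : seq T -> Prop) : Prop :=
  if n is m.+1 then
    forall c, exists2 a, lt c a & freq m (fun s => P (a :: s))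
  else P [::].

Fixpoint interlaced (c : T) (s t : seq T) : bool :=
  match s, t with
  | a :: s', b :: t' => [&& lt c a, lt a b & interlaced b s' t']
  | [::], [::] => true
  | _, _ => false
  end.

Lemma lt_bounded_seq (s : seq T) : T -> exists b, all (lt^~ b) s.
Proof.
move=> x0; have [b hb] := lt_bounded (nth x0 s).
by exists b; apply/(all_nthP x0) => k _; exact: hb.
Qed.

Lemma ev_mono n (P Q : seq T -> Prop) :
  (forall s, P s -> Q s) -> ev n P -> ev n Q.
Proof.
elim: n P Q => [|n IH] P Q PQ /=; first exact: PQ.
by case=> c hc; exists c => a /hc; apply: IH => s; exact: PQ.
Qed.

(** The thresholds belonging to the countably many predicates have a common
    upper bound, at each of the n levels. *)
Lemma ev_forall n (P : nat -> seq T -> Prop) :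
  (forall k, ev n (P k)) -> ev n (fun s => forall k, P k s).
Proof.
elim: n P => [//|n IH] P /= /choice[c hc].
have [b hb] := lt_bounded c; exists b => a ba.
by apply: IH => k; apply: hc; exact: lt_trans (hb k) ba.
Qed.

Lemma ev_and n (P Q : seq T -> Prop) :
  ev n P -> ev n Q -> ev n (fun s => P s /\ Q s).
Proof.
move=> hP hQ.
have := @ev_forall n (fun k => if k is 0 then P else Q).
move=> H; apply: ev_mono (H _) => [s h|[]//].
by split; [exact: (h 0%N)|exact: (h 1%N)].
Qed.

Lemma not_ev n (P : seq T -> Prop) :
  ~ ev n P -> freq n (fun s => ~ P s).
Proof.
elim: n P => [//|n IH] P /= /forallNP nP c.
by have /existsNP[a /not_implyP[ca /IH]] := nP c; exists a.
Qed.

Lemma ev_witness n (P : seq T -> Prop) (c : T) :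
  ev n P -> exists s, [/\ size s = n, all (lt c) s & P s].
Proof.
elim: n P => [|n IH] P /=; first by move=> P0; exists [::].
case=> d hd; have [a ha] := lt_bounded (fun k => if k is 0 then c else d).
have [s [sn cs Ps]] := IH _ (hd a (ha 1%N)).
by exists (a :: s); split => //=; [rewrite sn|rewrite (ha 0%N)].
Qed.

(** Two dual quantifiers can be played alternately, each choice being made
    above the last choice of the other side. *)
Lemma freq_interlaced n (P Q : seq T -> Prop) (c : T) :
  freq n P -> freq n Q ->
  exists s t, [/\ size s = n, size t = n, interlaced c s t, P s & Q t].
Proof.
elim: n P Q c => [|n IH] P Q c /=; first by exists [::], [::].
move=> /(_ c)[a ca hP] /(_ a)[b ab hQ].
have [s [t [sn tn st Ps Qt]]] := IH _ _ b hP hQ.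
by exists (a :: s), (b :: t); rewrite /= sn tn ca ab.
Qed.

Variable R : realType.

(** Countable completeness makes every real function bounded far out:
    otherwise it would exceed all the integers at some point. *)
Lemma ev_unbounded n (g : seq T -> R) (c : T) :
  ~ forall m : nat, ev n (fun s => m%:R <= g s).
Proof.
move=> /ev_forall/(ev_witness c)[s [_ _ /(_ (Num.bound `|g s|))]].
rewrite leNgt => /negP; apply; apply: le_lt_trans (ler_norm _) _.
exact: archi_boundP.
Qed.

(** The window lies below the iterated limsup of g, here the infimum of the r
    such that g <= r far out. If values well below it were taken arbitrarily
    far out, interlacing them with values close to it would contradict the
    bound on the oscillation. *)
Lemma ev_window n (g : seq T -> R) (d : R) (c : T) :
  0 < d ->
  (forall s t, size s = n -> size t = n -> interlaced c s t ->
     `|g s - g t| <= d) ->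
  exists r, ev n (fun s => r <= g s <= r + 3 * d).
Proof.
move=> d0 osc; pose S := [set r | ev n (fun s => g s <= r)].
have gap x y : freq n (fun s => ~ (x <= g s)) ->
    freq n (fun s => ~ (g s <= y)) -> y < x + d.
  move=> lo hi; rewrite ltNge; apply/negP => xy.
  have [s [t [sn tn /(osc _ _ sn tn)/ler_normlP[h _]]]] :=
    freq_interlaced c lo hi.
  move=> /negP gs /negP gt; move: gs gt h; rewrite -!ltNge; lra.
have hS : has_inf S.
  split.
    have /existsNP[m /not_ev lo] := @ev_unbounded n g c.
    exists (m%:R + d); apply: contrapT => /not_ev/(gap _ _ lo).
    by rewrite ltxx.
  have /existsNP[m hm] := @ev_unbounded n (fun s => - g s) c.
  exists (- m%:R) => r Sr; rewrite leNgt; apply/negP => rm; apply: hm.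
  by apply: ev_mono Sr => s; move: rm; lra.
have [r Sr rlt] := inf_adherent d0 hS.
exists (inf S - 2 * d).
apply: (@ev_mono _ (fun s => inf S - 2 * d <= g s /\ g s <= r)).
  by move=> s [-> /le_trans->//]; rewrite (le_trans (ltW rlt))//; lra.
apply: ev_and => //; apply: contrapT => /not_ev lo.
have /not_ev/(gap _ _ lo) : ~ S (inf S - d) by move=> /(ge_inf hS.2); lra.
lra.
Qed.

(** The windows of all the functions g k hold simultaneously, so a second
    tuple can be taken above the first one with all the entries g k still in
    the same windows. *)
Lemma small_oscillation_separated n (g : nat -> seq T -> R) (d : R) (c : T) :
  0 < d ->
  (forall k s t, size s = n -> size t = n -> interlaced c s t ->
     `|g k s - g k t| <= d) ->
  exists s b b' t,
    [/\ size s = n /\ size t = n, all (lt^~ b) s, lt b b', all (lt b') t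
      & forall k, `|g k s - g k t| <= 3 * d].
Proof.
move=> d0 osc.
have /choice[r hr] k := ev_window d0 (osc k).
have {hr}ev := ev_forall hr.
have [s [sn _ hs]] := ev_witness c ev.
have [b sb] := lt_bounded_seq s c.
have [b' /(_ 0%N) bb'] := lt_bounded (fun=> b).
have [t [tn bt ht]] := ev_witness b' ev.
exists s, b, b', t; split=> // k.
by move: (hs k) (ht k); rewrite ler_norml; lra.
Qed.

End iterated_quantifiers.

(** * Eventual domination of functions *)

Section eventual_domination.

Definition eventually_lt (f g : nat -> nat) : bool :=
  `[< exists M, forall m, (M <= m)%N -> (f m < g m)%N >].

Lemma eventually_lt_trans : transitive eventually_lt.
Proof.
move=> g f h /asboolP[M fg] /asboolP[N gh]; apply/asboolP.
exists (maxn M N) => m; rewrite geq_max => /andP[/fg + /gh].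
exact: ltn_trans.
Qed.

(** The diagonal bound exceeds s k at m as soon as k <= m. *)
Lemma eventually_lt_bounded (s : nat -> nat -> nat) :
  exists b, forall k, eventually_lt (s k) b.
Proof.
exists (fun m => (\max_(k < m.+1) s k m).+1) => k.
apply/asboolP; exists k => m km; rewrite ltnS.
exact: (leq_bigmax (Ordinal (km : (k < m.+1)%N))).
Qed.

End eventual_domination.

(** * Families of sets that increase modulo an ideal *)

Section almost_increasing_sets.

Lemma ideal_bigcup (I : set (set nat)) (F : nat -> set nat) n :
  is_ideal I -> I !=set0 -> (forall k, I (F k)) -> I (\bigcup_(k in `I_n) F k).
Proof.
move=> [IU Isub] [A IA] IF; rewrite bigcup_mkord.
by apply: big_ind => //; exact: Isub IA _.
Qed.

(** E f is the part of the array (D_(m, n)), the sets D_k reindexed by pairs,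
    below the graph of f. If g dominates f, only finitely many columns of the
    array contribute to E f \ E g, with finitely many sets each. *)
Lemma much_larger_almost_increasing (i j : set (set nat)) :
  is_ideal i -> is_ideal j -> much_larger i j ->
  exists E : (nat -> nat) -> set nat,
    [/\ forall f, j (E f),
        forall f g, eventually_lt f g -> i (E f `\` E g) &
        forall f g, eventually_lt f g -> ~ i (E g `\` E f)].
Proof.
move=> hi hj hij; have i0 := much_larger_neq0l hij.
case: hij => _ [D [iD _ disjD jD]].
exists (fun f => \bigcup_(p in [set p | (p.2 <= f p.1)%N]) D (pickle p)); split.
- move=> f; apply: hj.2 (proj1 (jD _ infinite_nat)) _ => x [p _ Dx].
  by exists (pickle p).
- move=> f g /asboolP[M fg].
  apply: hi.2 (ideal_bigcup M hi i0 (fun m =>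
    ideal_bigcup (f m).+1 hi i0 (fun n => iD (pickle (m, n))))) _.
  move=> x [[[m n] /= nf Dx] nEg]; exists m; last by exists n.
  rewrite /= ltnNge; apply/negP => Mm; apply: nEg; exists (m, n) => //=.
  exact: leq_trans nf (ltnW (fg _ Mm)).
- move=> f g /asboolP[M fg] iE.
  (* the points (m, g m) on the graph of g lie above that of f for m large *)
  pose K := [set pickle (m, g m) | m in [set m | (M <= m)%N]].
  have Kinf : infinite_set K.
    move=> Kfin; apply: infinite_nat.
    apply: (@sub_finite_set _ _
      (`I_M `|` [set odflt 0%N (omap fst (unpickle k : option (nat * nat)))
                | k in K])).
      move=> m _; have [mM|Mm] := ltnP m M; [by left|right].
      by exists (pickle (m, g m)); [exists m|rewrite /= pickleK].
    by rewrite finite_setU; split; [exact: finite_II|exact: finite_image].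
  apply: (proj2 (jD K Kinf)); apply: hi.2 iE _ => x [_ [m /= Mm <-] Dx].
  split; first by exists (m, g m) => /=.
  move=> [[m' n] /= nf Dx'].
  have /(pcan_inj pickleK)[mm' gn] : pickle (m, g m) = pickle (m', n).
    by apply: disjD => //; exists x.
  by move: nf; rewrite -gn -mm' leqNgt fg.
Qed.

End almost_increasing_sets.

(** * Entries of sequences in a closed subspace *)

Section entries.
Variable R : realType.

(** Vector operations are unfolded here and below one layer of subtype at a
    time: unfolding both layers at once makes conversion prohibitively slow. *)
Lemma linftyD (u v : linfty R) p : (u + v) p = u p + v p.
Proof. by []. Qed.

Lemma linftyZ a (u : linfty R) p : (a *: u) p = a * u p.
Proof. by []. Qed.

Lemma subNormedD (U : normedModType R) (S : closedSubspace U)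
    (x y : subNormed S) :
  subNormed_val (x + y) = subNormed_val x + subNormed_val y.
Proof. by []. Qed.

Lemma subNormedZ (U : normedModType R) (S : closedSubspace U) a
    (x : subNormed S) : subNormed_val (a *: x) = a *: subNormed_val x.
Proof. by []. Qed.

Variable S : closedSubspace (linfty R).
Implicit Types x y : subNormed S.

Definition entry x (p : nat) : R := subNormed_val x p.

Lemma entryD x y p : entry (x + y) p = entry x p + entry y p.
Proof. by rewrite /entry subNormedD linftyD. Qed.

Lemma entryZ a x p : entry (a *: x) p = a * entry x p.
Proof. by rewrite /entry subNormedZ linftyZ. Qed.

Lemma entry0 p : entry 0 p = 0.
Proof. by rewrite -(scale0r 0) entryZ mul0r. Qed.

Lemma entryB x y p : entry (x - y) p = entry x p - entry y p.
Proof. by rewrite -scaleN1r entryD entryZ mulN1r. Qed.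

Lemma entry_le_norm x p : `|entry x p| <= `|x|.
Proof. exact: ler_sup_norm. Qed.

Lemma norm_le_entry x (C : R) : (forall p, `|entry x p| <= C) -> `|x| <= C.
Proof. exact: sup_norm_le. Qed.

End entries.

(** * The quotient norm modulo ideal-null sequences *)

Lemma quot_mapB (R : realType) (V : normedModType R) (S : closedSubspace V)
    x y :
  quot_map S (x - y) = quot_map S x - quot_map S y.
Proof. by apply/esym/eqP; rewrite subr_eq -quot_mapD subrK. Qed.

Section quotient_norm.
Variables (R : realType) (i j : set (set nat)).
Variables (hi : is_ideal i) (i0 : i !=set0) (hj : is_ideal j) (j0 : j !=set0).
Let jc0 := ideal_c0_space R hj j0.
Let ic0 := trace_space (ideal_c0_space R hi i0) jc0.
Local Notation V := (subNormed jc0).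

Lemma ideal_c0_dominated (u : linfty R) (x : V) :
  (forall p, `|u p| <= `|entry x p|) -> u \in csub_mem jc0.
Proof.
move=> ux; apply/csub_memP/ideal_c0P => e e0.
have /csub_memP/ideal_c0P/(_ e e0) := subNormed_valP x.
by move/hj.2; apply => p /= /le_trans; apply; exact: ux.
Qed.

(** Replacing x by its restriction to the complement of Z does not change its
    class. *)
Lemma quot_norm_le_off (x : V) (Z : set nat) (C : R) :
  i Z -> 0 <= C -> (forall p, ~ Z p -> `|entry x p| <= C) ->
  `|quot_map ic0 x| <= C.
Proof.
move=> iZ C0 xC; pose w p : R^o := if p \in Z then entry x p else 0.
have wx p : `|w p| <= `|entry x p|.
  by rewrite /w; case: ifP => // _; rewrite normr0.
have wb : w \in @bounded_seq R.
  by apply/bounded_seqP; exists `|x| => p; exact: le_trans (entry_le_norm _ _).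
pose W : V := SubNormed (ideal_c0_dominated (u := Linfty wb) wx).
have -> : quot_map ic0 x = quot_map ic0 (x - W).
  apply/quot_mapP; rewrite opprB addrC subrK.
  apply/ideal_c0P => e e0; apply: hi.2 iZ _ => p /=.
  rewrite /w; case: ifPn => [/set_mem//|_].
  by rewrite normr0 leNgt e0.
apply: le_trans (quot_norm_le _ _) _; apply: norm_le_entry => p.
rewrite entryB {2}/entry/= /w; case: ifPn => [_|/negP Zp].
  by rewrite subrr normr0.
by rewrite subr0; apply: xC => Zp'; apply: Zp; exact: mem_set.
Qed.

(** A representative of the class of x of norm less than C would differ from x
    by a fixed positive amount at all points of A. *)
Lemma quot_norm_ge_on (x : V) (A : set nat) (C : R) :
  ~ i A -> (forall p, A p -> C <= `|entry x p|) -> C <= `|quot_map ic0 x|.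
Proof.
move=> niA xC; apply/ler_addgt0Pr => e e0.
have [y qy /ltW] := quot_norm_lt (quot_map ic0 x) e0; apply: le_trans.
rewrite leNgt; apply/negP => yC; apply: niA.
move/esym/quot_mapP/ideal_c0P : qy => /(_ (C - `|y|)); rewrite subr_gt0.
move=> /(_ yC)/hi.2; apply => p /xC Cx.
suff : C - `|y| <= `|entry (x - y) p| by [].
rewrite entryB lerBlDr (le_trans Cx)//.
have := ler_normD (entry x p - entry y p) (entry y p).
by rewrite subrK => /le_trans->//; rewrite lerD2l entry_le_norm.
Qed.

End quotient_norm.

(** * Averages of indicators of almost increasing sets *)

Section averages.
Variables (R : realType) (i j : set (set nat)).
Variables (hi : is_ideal i) (i0 : i !=set0) (hj : is_ideal j) (j0 : j !=set0).
Let jc0 := ideal_c0_space R hj j0.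
Let ic0 := trace_space (ideal_c0_space R hi i0) jc0.
Local Notation V := (subNormed jc0).
Local Notation q := (@quot_map R V ic0).

Variables (T : Type) (lt : rel T) (E : T -> set nat).
Hypothesis Ej : forall a, j (E a).
Hypothesis E_almost_incr : forall a b, lt a b -> i (E a `\` E b).
Hypothesis E_strict : forall a b, lt a b -> ~ i (E b `\` E a).

Definition ind (a : T) (p : nat) : R^o := (p \in E a)%:R.

Lemma ind_itv a p : 0 <= ind a p <= 1.
Proof. by rewrite /ind; case: (p \in E a); rewrite lexx ler01. Qed.

Lemma ind_mono a b p : ~ (E a `\` E b) p -> ind a p <= ind b p.
Proof.
move=> nab; rewrite /ind ler_nat; case: (boolP (p \in E a)) => // /set_mem pa.
by rewrite lt0n eqb0 negbK; apply: mem_set; apply: contrapT => pb; exact: nab.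
Qed.

Lemma ind_bounded a : ind a \in @bounded_seq R.
Proof.
apply/bounded_seqP; exists 1 => p; have /andP[p0 p1] := ind_itv a p.
by rewrite ger0_norm.
Qed.

Lemma ind_jc0 a : Linfty (ind_bounded a) \in csub_mem jc0.
Proof.
apply/csub_memP/ideal_c0P => e e0; apply: hj.2 (Ej a) _ => p /=.
rewrite /ind; case: (boolP (p \in E a)) => [/set_mem//|_].
by rewrite normr0 leNgt e0.
Qed.

Definition average (s : seq T) : V :=
  (size s)%:R^-1 *: \sum_(a <- s) SubNormed (ind_jc0 a).

Lemma entry_average s p :
  entry (average s) p = (size s)%:R^-1 * \sum_(a <- s) ind a p.
Proof.
rewrite entryZ; congr (_ * _); elim: s => [|a s IH].
  by rewrite !big_nil entry0.
by rewrite !big_cons entryD IH.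
Qed.

Lemma norm_average s : `|average s| <= 1.
Proof.
apply: norm_le_entry => p; rewrite entry_average.
have /andP[S0 Sn] : 0 <= \sum_(a <- s) ind a p <= (size s)%:R.
  elim: s => [|a s IH]; first by rewrite big_nil lexx.
  rewrite big_cons /= -natr1; move: IH (ind_itv a p); lra.
rewrite ger0_norm ?mulr_ge0// ?invr_ge0//.
have [->|s0] := eqVneq (size s) 0%N; first by rewrite invr0 mul0r ler01.
by rewrite ler_pdivrMl ?mulr1// ltr0n lt0n.
Qed.

(** Off a set of i the indicators increase along the chain
    c < s_1 < t_1 < s_2 < ...; the term - ind c p in the upper bound is what
    makes the induction work, as the sum of the jumps after c can only use
    what remains between ind c p and 1. *)
Lemma interlaced_ind c s t : interlaced lt c s t ->
  exists2 Z, i Z & forall p, ~ Z p ->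
    0 <= \sum_(b <- t) ind b p - \sum_(a <- s) ind a p <= 1 - ind c p.
Proof.
elim: s c t => [|a s IH] c [|b t]//=.
  move=> _; have [A iA] := i0; exists A => // p _.
  by rewrite !big_nil; move: (ind_itv c p); lra.
move=> /and3P[ca ab /IH[Z iZ hZ]].
exists (Z `|` ((E c `\` E a) `|` (E a `\` E b))).
  by apply: hi.1 => //; apply: hi.1; exact: E_almost_incr.
move=> p /not_orP[/hZ + /not_orP[/ind_mono + /ind_mono]].
by rewrite !big_cons; lra.
Qed.

Lemma quot_average_interlaced c n s t : interlaced lt c s t ->
  size s = n.+1 -> size t = n.+1 ->
  `|q (average s) - q (average t)| <= n.+1%:R^-1.
Proof.
move=> /interlaced_ind[Z iZ hZ] sn tn.
rewrite -quot_mapB.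
apply: (@quot_norm_le_off R i j hi i0 hj j0 _ _ _ iZ) => // p /hZ.
rewrite entryB !entry_average sn tn -mulrBr normrM => h.
rewrite ger0_norm// ler_piMr// ler_norml.
by move: h (ind_itv c p); lra.
Qed.

Lemma sum_ind_below b s : all (lt^~ b) s ->
  exists2 Z, i Z & forall p, ~ Z p -> ~ E b p -> \sum_(a <- s) ind a p = 0.
Proof.
elim: s => [|a s IH] /=.
  by move=> _; have [A iA] := i0; exists A => // p _ _; rewrite big_nil.
move=> /andP[ab /IH[Z iZ hZ]]; exists (Z `|` (E a `\` E b)).
  by apply: hi.1 => //; exact: E_almost_incr.
move=> p /not_orP[Zp ap] Eb; rewrite big_cons hZ// addr0 /ind memNset//.
by move=> Ea; exact: ap.
Qed.

Lemma sum_ind_above b s : all (lt b) s ->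
  exists2 Z, i Z & forall p, ~ Z p -> E b p ->
    \sum_(a <- s) ind a p = (size s)%:R.
Proof.
elim: s => [|a s IH] /=.
  by move=> _; have [A iA] := i0; exists A => // p _ _; rewrite big_nil.
move=> /andP[ab /IH[Z iZ hZ]]; exists (Z `|` (E b `\` E a)).
  by apply: hi.1 => //; exact: E_almost_incr.
move=> p /not_orP[Zp ap] Eb; rewrite big_cons hZ// -natr1 addrC /ind mem_set//.
by apply: contrapT => Ea; exact: ap.
Qed.

(** Off a set of i, the first average is 0 outside E b and the second is 1 on
    E b'. *)
Lemma quot_average_separated b b' n s t :
  all (lt^~ b) s -> lt b b' -> all (lt b') t -> size t = n.+1 ->
  1 <= `|q (average s) - q (average t)|.
Proof.
move=> /sum_ind_below[Y iY hY] bb' /sum_ind_above[Z iZ hZ] tn.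
rewrite -quot_mapB.
apply: (@quot_norm_ge_on R i j hi i0 hj j0 _ ((E b' `\` E b) `\` (Y `|` Z))).
  move=> iD; apply: (E_strict bb').
  apply: hi.2 (hi.1 _ _ iD (hi.1 _ _ iY iZ)) _ => p Ep.
  by have [|] := pselect ((Y `|` Z) p); [right|left].
move=> p [[Eb' Eb] /not_orP[Yp Zp]].
rewrite entryB !entry_average hY// hZ// mulr0 sub0r normrN tn.
by rewrite mulVf ?pnatr_eq0// normr1.
Qed.

End averages.

(** * Uniform continuity and sections in terms of norms *)

Section quotient_sections.
Variable R : realType.

Lemma unif_continuous_subspace_norm (U W : normedModType R) (A : set U)
    (f : U -> W) :
  unif_continuous (f : subspace A -> W) ->
  forall e, 0 < e -> exists2 d, 0 < d &
    forall x y, A x -> A y -> `|x - y| < d -> `|f x - f y| < e.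
Proof.
move=> fA e e0.
have : entourage [set xy : W * W | ball xy.1 e xy.2].
  by rewrite -entourage_ballE; exists e.
move=> /fA[D]; rewrite -entourage_ballE => -[d /= d0 dD] DA.
exists d => // x y Ax Ay xy.
have /= : ball (f x) e (f y).
  by apply: (DA (x, y)); right; split=> //; split=> //; apply: dD;
    rewrite -ball_normE.
by rewrite -ball_normE.
Qed.

Lemma unif_continuous_norm (U W : normedModType R) (f : U -> W) :
  unif_continuous f ->
  forall e, 0 < e -> exists2 d, 0 < d &
    forall x y, `|x - y| < d -> `|f x - f y| < e.
Proof.
move=> /unif_continuousP fU e /fU[d d0 fd]; exists d => // x y.
by have := fd (x, y); rewrite -!ball_normE.
Qed.

(** The map id - P vanishes on S, hence factors through the quotient; the
    factor is a right inverse because P takes its values in S, and it inherits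
    the Lipschitz constant 1 + r of id - P. *)
Lemma complemented_section (V : normedModType R) (S : closedSubspace V) :
  complemented S ->
  exists2 tau : quotNormed S -> V, forall z, quot_map S (tau z) = z &
    forall e, 0 < e -> exists2 d, 0 < d &
      forall z w, `|z - w| < d -> `|tau z - tau w| < e.
Proof.
move=> [P [Pc PP PS]].
have fixP x : csub_set S x -> P x = x by rewrite -PS => -[y _ <-].
have rangeP x : csub_set S (P x) by rewrite -PS; exists x.
have /linear_bounded_continuous/linear_boundedP/pinfty_ex_gt0[r r0 rP] := Pc.
have /choice[rep repK] := @quot_map_surj _ _ S.
exists (fun z => rep z - P (rep z)) => [z|e e0].
  rewrite -[RHS]repK; apply/esym/quot_mapP.
  by rewrite opprB addrC subrK.
have r1 : 0 < 1 + r by rewrite addr_gt0.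
exists (e / (1 + r)) => [|z w]; first by rewrite divr_gt0.
(* a representative v of z - w of norm less than e / (1 + r) *)
rewrite -subr_gt0 => /(quot_norm_lt (z - w))[v qv].
rewrite [X in _ < X]addrC subrK => vlt.
have -> : rep z - P (rep z) - (rep w - P (rep w)) = v - P v.
  have /quot_mapP/fixP PD : quot_map S (rep z - rep w) = quot_map S v.
    by rewrite quot_mapB !repK qv.
  transitivity ((rep z - rep w) - P (rep z - rep w)).
    by rewrite (linearB P) !opprD !opprK addrACA.
  rewrite -[rep z - rep w](subrK v) (linearD P) PD.
  by rewrite opprD addrACA subrr add0r.
rewrite (le_lt_trans (ler_normB _ _))//.
rewrite (le_lt_trans (lerD (lexx _) (rP v)))//.
by rewrite -{1}[`|v|]mul1r -mulrDl mulrC -ltr_pdivlMr.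
Qed.

End quotient_sections.

(** * Collapse of separated points by uniformly continuous maps *)

Section no_uniform_embedding.
Variables (R : realType) (i j : set (set nat)).
Variables (hi : is_ideal i) (hj : is_ideal j) (hij : much_larger i j).
Let jc0 := ideal_c0_space R hj (much_larger_neq0r hij).
Let ic0 := trace_space (ideal_c0_space R hi (much_larger_neq0l hij)) jc0.
Local Notation V := (subNormed jc0).
Local Notation Q := (quotNormed ic0).

(** Applied to the averages of n + 1 indicators, with 1 / (n + 1) less than the
    modulus of uniform continuity d: interlaced tuples have images less than e
    apart, and the entries of F are the countable family of real functions to
    which [small_oscillation_separated] applies. *)
Lemma unif_continuous_collapse (F : Q -> V) (e : R) : 0 < e ->
  (exists2 d, 0 < d & forall z w : Q, `|z| <= 1 -> `|w| <= 1 ->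
    `|z - w| < d -> `|F z - F w| < e) ->
  exists z w : Q, [/\ `|z| <= 1, `|w| <= 1, 1 <= `|z - w| &
    `|F z - F w| <= 3 * e].
Proof.
move=> e0 [d d0 Fd].
have [E [Ej Ei Es]] := much_larger_almost_increasing hi hj hij.
pose u s : Q := quot_map ic0 (average R hj (much_larger_neq0r hij) Ej s).
have u1 s : `|u s| <= 1.
  exact: le_trans (quot_norm_le _ _) (norm_average _ _ _ _ _).
have [n nd] : exists n, n.+1%:R^-1 < d.
  by have [n nd] := ltr_add_invr d0; exists n; rewrite -[ltLHS]add0r.
pose g k s := entry (F (u s)) k.
have osc k s t : size s = n.+1 -> size t = n.+1 ->
    interlaced eventually_lt (fun=> 0%N) s t -> `|g k s - g k t| <= e.
  move=> sn tn st; rewrite -entryB (le_trans (entry_le_norm _ _))// ltW// Fd//.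
  apply: le_lt_trans nd.
  exact: (quot_average_interlaced R hi (much_larger_neq0l hij) hj
    (much_larger_neq0r hij) Ej Ei st sn tn).
have [s [b [b' [t [[sn tn] sb bb' bt gst]]]]] :=
  small_oscillation_separated eventually_lt_trans eventually_lt_bounded e0 osc.
exists (u s), (u t); split=> //.
  exact: (quot_average_separated R hi (much_larger_neq0l hij) hj
    (much_larger_neq0r hij) Ej Ei Es sb bb' bt tn).
by apply: norm_le_entry => k; rewrite entryB; exact: gst.
Qed.

End no_uniform_embedding.

Theorem corollary3p8 (R : realType) (i j : set (set nat))
    (hi : is_ideal i) (hj : is_ideal j) (hij : much_larger i j) :
  let ic0 := ideal_c0_space R hi (much_larger_neq0l hij) in
  let jc0 := ideal_c0_space R hj (much_larger_neq0r hij) in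
  let ic0_in_jc0 := trace_space ic0 jc0 in
  let q := @quot_map R (subNormed jc0) ic0_in_jc0 in
  [/\ ~ unif_embeds (subNormed jc0)
          [set z : quotNormed ic0_in_jc0 | `|z| <= 1],
      ~ complemented ic0_in_jc0 &
      ~ exists tau : quotNormed ic0_in_jc0 -> subNormed jc0,
          unif_continuous tau /\ (forall z, q (tau z) = z)].
Proof.
move=> ic0 jc0 ic0_in_jc0 q.
have no_section (tau : quotNormed ic0_in_jc0 -> subNormed jc0) :
    (forall z, q (tau z) = z) ->
    ~ forall e, 0 < e -> exists2 d, 0 < d &
      forall z w, `|z - w| < d -> `|tau z - tau w| < e.
  move=> qtau tauU; have e0 : 0 < 4^-1 :> R by rewrite invr_gt0.
  have [|z [w [_ _ zw1 tauzw]]] := unif_continuous_collapse (F := tau) e0.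
    by have [d d0 hd] := tauU _ e0; exists d => // z w _ _; exact: hd.
  have : `|z - w| <= `|tau z - tau w|.
    rewrite -[in leLHS](qtau z) -[in leLHS](qtau w) -quot_mapB.
    exact: quot_norm_le.
  by move: zw1 tauzw; lra.
split.
- move=> [f [_ /unif_continuous_subspace_norm fU [g fK]]].
  move=> /unif_continuous_subspace_norm/(_ 1 ltr01)[d d0 gd].
  have e0 : 0 < d / 4 by rewrite divr_gt0.
  have [|z [w [z1 w1 zw1 fzw]]] := unif_continuous_collapse (F := f) e0.
    by have [c c0 hc] := fU _ e0; exists c => // z w; exact: hc.
  have : `|g (f z) - g (f w)| < 1.
    by apply: gd; [exists z|exists w|apply: le_lt_trans fzw _; lra].
  by rewrite !fK ?inE// ltNge zw1.
- by move=> /complemented_section[tau]; exact: no_section.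
- move=> [tau [/unif_continuous_norm tauU qtau]].
  exact: no_section qtau tauU.
Qed.
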